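(* Let $B=\{(x,y)\in\mathbb{R}^2 \mid y\ge 0,\ x^2+y^2\le 1\}$, $P(x,y)=(x+iy)^2$ and $Q(x,y)=x+iy$, where $i=\sqrt{-1}$. Then $\int_B P(x,y)^m\,dx\,dy=0$ for all integers $m\ge 1$, but $\int_B Q(x,y)P(x,y)^m\,dx\,dy\ne 0$ for all integers $m\ge 1$. *)

(* Defs.v *)
From HB Require Import structures.
From mathcomp Require Import all_boot all_order all_algebra.
From mathcomp Require Import all_classical all_reals all_analysis.
From mathcomp.real_closed Require Import complex.

Set Implicit Arguments.
Unset Strict Implicit.
Unset Printing Implicit Defensive.

Import Order.TTheory GRing.Theory Num.Theory.
Import numFieldNormedType.Exports.

Local Open Scope classical_set_scope.
Local Open Scope ring_scope.
Local Open Scope complex_scope.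

(* MathComp-Analysis only integrates (extended) real-valued functions, so the
   integral of a complex-valued function is taken componentwise.  Like
   [Rintegral], it is a total operator: it is meaningful when both components
   are integrable, as is the case for a continuous function on a compact set. *)
Definition Cintegral (d : measure_display) (T : measurableType d)
    (R : realType) (mu : {measure set T -> \bar R}) (D : set T) (f : T -> R[i]) : R[i] :=
  (\int[mu]_(t in D) complex.Re (f t)) +i*
  (\int[mu]_(t in D) complex.Im (f t)).

Definition lebesgue_measure2 (R : realType) :
    {measure set (measurableTypeR R * measurableTypeR R) -> \bar R} :=
  (@lebesgue_measure R \x @lebesgue_measure R)%E.

Definition B (R : realType) : set (R * R) :=
  [set p | 0 <= p.2 /\ p.1 ^+ 2 + p.2 ^+ 2 <= 1].

(* ['i%C] is the pair (0, 1); without the scope delimiter ['i] could be read as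
   the imaginary unit of an abstract [numClosedFieldType]. *)
Definition P (R : realType) (p : R * R) : R[i] :=
  (p.1%:C + 'i%C * p.2%:C) ^+ 2.

Definition Q (R : realType) (p : R * R) : R[i] :=
  p.1%:C + 'i%C * p.2%:C.

(* Main.v *)
Require Import Defs.
From mathcomp Require Import all_boot all_order all_algebra.
From mathcomp Require Import all_classical all_reals all_analysis.
From mathcomp.real_closed Require Import complex.
From mathcomp Require Import measurable_realfun ring lra.

(** Write z = x + iy.  Both parts follow from one formula: for n >= 1,
      int_B z^n dx dy = i (1 - (-1)^n) / (n (n + 2)),
    which vanishes for n even and equals 2i / (n (n + 2)) for n odd; the theorem
    takes n = 2m and n = 2m + 1.  In polar coordinates the formula is the
    integral of r^(n+1) over [0, 1] times that of e^(i n theta) over [0, pi].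
    The proof stays in Cartesian coordinates and obtains it from Fubini
    ([Rintegral_B_Repow]) and two applications of the fundamental theorem of
    calculus.

    For fixed y in [0, 1] the slice of B is [-s, s] with s = sqrt (1 - y^2), and
    x |-> z^(n+1) / (n+1) is a primitive of x |-> z^n, so the inner integral is
      (w_+^(n+1) - w_-^(n+1)) / (n+1),   w_+ = s + iy,  w_- = -s + iy
    ([integral_horizontal_Repow]).  As y varies, w_+ and w_- run over the two
    quarter circles that bound B, and along each of them w^(n+1) has the primitive
      - (i/2) (w^(n+2) / (n+2) + w^n / n)
    ([is_derive_arc_prim]): on the unit circle 2 x w^(n+1) = w^(n+2) + w^n, and
    the motion at unit speed in y gives x w' = i w.  The arcs meet at i, so their
    contributions at y = 1 cancel; at y = 0 they start from 1 and -1, whence the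
    factor 1 - (-1)^n ([integral_arcs]).

    Real and imaginary parts are treated together, as the real part of c z^n
    for c = 1 and c = -i. *)

Set Implicit Arguments.
Unset Strict Implicit.
Unset Printing Implicit Defensive.

Import Order.TTheory GRing.Theory Num.Theory.
Import numFieldNormedType.Exports.

Local Open Scope classical_set_scope.
Local Open Scope ring_scope.

(** * Real parts of multiples of complex powers *)

Section Repow.
Variable R : realType.
Implicit Types (c : R[i]) (n : nat) (x y : R).

(** The factor [c] makes the family stable under differentiation, which
    multiplies [c] by the velocity of the curve, and it gives access to the
    imaginary part with c = -i. *)
Definition Repow c n x y : R := complex.Re (c * (x +i* y)%C ^+ n).

(** This recurrence reduces analytic facts on powers of z to sums and products
    of real functions. *)
Lemma RepowS c n x y :
  Repow c n.+1 x y = x * Repow c n x y + y * Repow (c * 'i%C) n x y.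
Proof.
rewrite /Repow exprS; case: c => a b; case: (_ ^+ n) => u v /=; ring.
Qed.

(** The chain rule for z^(n+1) along the curve z = X + iY, with z' = dX + i dY. *)
Lemma is_derive_Repow c n (X Y : R -> R) (t dX dY : R) :
  is_derive t 1 X dX -> is_derive t 1 Y dY ->
  is_derive t 1 (fun u => Repow c n.+1 (X u) (Y u))
    (Repow (c * (n.+1%:R * (dX +i* dY)%C)) n (X t) (Y t)).
Proof.
move=> hX hY; elim: n c => [|n IHn] c.
  rewrite (_ : (fun _ => _) =
      X * cst (Repow c 0 0 0) + Y * cst (Repow (c * 'i%C) 0 0 0)); last first.
    by apply/funext => u; rewrite RepowS.
  apply: (is_derive_eq (is_deriveD (is_deriveM hX (is_derive_cst _ _ _))
    (is_deriveM hY (is_derive_cst _ _ _)))).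
  rewrite /Repow !expr0 /= /GRing.scale /=.
  case: c => a b /=; ring.
rewrite (_ : (fun _ => _) = X * (fun u => Repow c n.+1 (X u) (Y u))
    + Y * (fun u => Repow (c * 'i%C) n.+1 (X u) (Y u))); last first.
  by apply/funext => u; rewrite RepowS.
apply: (is_derive_eq (is_deriveD (is_deriveM hX (IHn c))
  (is_deriveM hY (IHn (c * 'i%C))))).
rewrite /Repow /= /GRing.scale /=.
rewrite exprS; case: c => a b; case: (_ ^+ n) => u v /=.
rewrite -[n.+2]addn1 natrD mulrDl; case: (n.+1%:R) => p q /=; ring.
Qed.

Lemma continuous_Repow c n (T : topologicalType) (X Y : T -> R) :
  continuous X -> continuous Y ->
  continuous (fun u => Repow c n (X u) (Y u)).
Proof.
move=> cX cY; elim: n c => [|n IHn] c t; first exact: cvg_cst.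
under eq_fun do rewrite RepowS.
by apply: cvgD; apply: cvgM; [exact: cX|exact: IHn|exact: cY|exact: IHn].
Qed.

Lemma measurable_Repow c n d (T : measurableType d) (D : set T) (X Y : T -> R) :
  measurable_fun D X -> measurable_fun D Y ->
  measurable_fun D (fun u => Repow c n (X u) (Y u)).
Proof.
move=> mX mY; elim: n c => [|n IHn] c.
  by rewrite (_ : (fun _ => _) = cst (Repow c 0 0 0)).
under eq_fun do rewrite RepowS.
by apply: measurable_funD; exact: measurable_funM.
Qed.

(** On the unit disc |c z^n| <= |c|. *)
Lemma Repow_le c n x y : x ^+ 2 + y ^+ 2 <= 1 ->
  `|Repow c n x y| <= Num.sqrt (complex.Re c ^+ 2 + complex.Im c ^+ 2).
Proof.
move=> xy1; rewrite -lecR -normc_def (le_trans (normc_ge_Re _))//.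
rewrite normrM normrX ler_piMr// exprn_ile1// normc_def /= lecR.
by rewrite -[leRHS]sqrtr1 ler_sqrt.
Qed.

(** * Integration along the chords and the arcs of the half disc *)

(** Differentiability is required only inside the interval: at y = 1 the
    tangents of the arcs bounding the half disc are horizontal, and the
    primitive used there is the composite of a polynomial with a square root
    that is not differentiable.  The case a = b covers the chord at y = 1. *)
Lemma integral_itv_derive (f F : R -> R) a b :
  a <= b -> continuous f -> continuous F ->
  {in `]a, b[, forall x, is_derive x 1 F (f x)} ->
  (\int[lebesgue_measure]_(x in `[a, b]) (f x)%:E)%E = (F b - F a)%:E.
Proof.
rewrite le_eqVlt => /predU1P[<- _ _ _|ab cf cF dF].
  by rewrite set_itv1 integral_set1 subrr.
rewrite (continuous_FTC2 (F := F) ab)//.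
- exact: continuous_subspaceT.
- split.
  + by move=> x /dF [].
  + exact/cvg_at_right_filter/cF.
  + exact/cvg_at_left_filter/cF.
- by move=> x /dF dFx; rewrite derive1E derive_val.
Qed.

(** Half the length of the horizontal chord of the unit disc at height y. *)
Definition chord y : R := Num.sqrt (1 - y ^+ 2).

Lemma sqr_chord y : 0 <= y <= 1 -> chord y ^+ 2 = 1 - y ^+ 2.
Proof. by move=> y01; rewrite sqr_sqrtr//; nra. Qed.

Lemma continuous_chord : continuous chord.
Proof.
move=> y; apply: continuous_comp; last exact: sqrt_continuous.
by apply: cvgB; [exact: cvg_cst|exact: exprn_continuous].
Qed.

Lemma is_derive_chord y : 0 < y < 1 -> is_derive y 1 chord (- y / chord y).
Proof.
move=> y01.
have d1 : is_derive y 1 (fun u : R => 1 - u ^+ 2) (- (2 * y)).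
  apply: is_derive_eq; rewrite /GRing.scale /=; ring.
have y2 : 0 < 1 - y ^+ 2 by nra.
have d2 := is_derive1_sqrt y2.
have := is_derive1_comp (g := fun u => 1 - u ^+ 2) d2 d1.
rewrite (_ : _ * _ = - y / chord y)// /chord.
have : Num.sqrt (1 - y ^+ 2) != 0 by rewrite gt_eqF// sqrtr_gt0.
by move=> ?; field.
Qed.

Lemma integral_horizontal_Repow c n y :
  (\int[lebesgue_measure]_(x in `[(- chord y)%R, chord y]) (Repow c n x y)%:E)%E =
  (Repow (c / n.+1%:R) n.+1 (chord y) y -
   Repow (c / n.+1%:R) n.+1 (- chord y) y)%:E.
Proof.
apply: (integral_itv_derive (F := fun x => Repow (c / n.+1%:R) n.+1 x y)).
- by have := sqrtr_ge0 (1 - y ^+ 2); rewrite -/(chord y); lra.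
- by apply: continuous_Repow => x; [exact: cvg_id|exact: cvg_cst].
- by apply: continuous_Repow => x; [exact: cvg_id|exact: cvg_cst].
- move=> x _.
  have := is_derive_Repow (c / n.+1%:R) n (is_derive_id x 1) (is_derive_cst y x 1).
  rewrite (_ : c / _ * _ = c)// mulrA mulfVK ?pnatr_eq0//.
  by rewrite [X in _ * X](_ : _ = 1) ?mulr1.
Qed.

(** For e = 1 or e = -1, the function c (-i/2) (w^(n+2) / (n+2) + w^n / n) on the
    right or left arc w = e s + iy of the unit circle. *)
Definition arc_prim c e n y : R :=
  Repow (c * (- 'i%C / 2) / n.+2%:R) n.+2 (e * chord y) y +
  Repow (c * (- 'i%C / 2) / n%:R) n (e * chord y) y.

Lemma continuous_scaled_chord e : continuous (fun y => e * chord y).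
Proof. by move=> y; apply: cvgM; [exact: cvg_cst|exact: continuous_chord]. Qed.

Lemma continuous_arc_prim c e n : continuous (arc_prim c e n).
Proof.
have cid : continuous (fun y : R => y) by move=> y; exact: cvg_id.
have ce := @continuous_scaled_chord e.
have cR a m := @continuous_Repow a m _ _ _ ce cid.
by move=> y; apply: cvgD; exact: cR.
Qed.

(** The chain rule gives c (-i/2) w' (w^(n+1) + w^(n-1)).  On the unit circle
    w^2 + 1 = 2 x w and x w' = i w, so that (-i) w' (w^2 + 1) = 2 w^2, and the
    derivative collapses to c w^(n+1). *)
Lemma is_derive_arc_prim c e n y : e ^+ 2 = 1 -> 0 < y < 1 ->
  is_derive y 1 (arc_prim c e n.+1) (Repow c n.+2 (e * chord y) y).
Proof.
move=> e1 y01; have dchord := is_derive_chord y01.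
have dX : is_derive y 1 (fun u : R => e * chord u) (e * (- y / chord y)).
  by apply: is_derive_eq; rewrite /GRing.scale /=; ring.
have d1 := is_derive_Repow (c * (- 'i%C / 2) / n.+3%:R) n.+2 dX (is_derive_id y 1).
have d2 := is_derive_Repow (c * (- 'i%C / 2) / n.+1%:R) n dX (is_derive_id y 1).
have := is_deriveD d1 d2.
rewrite (_ : _ + Repow _ _ _ _ = Repow c n.+2 (e * chord y) y)//.
have s0 : chord y != 0 by rewrite gt_eqF// sqrtr_gt0; nra.
have s2 : chord y ^+ 2 = 1 - y ^+ 2 by apply: sqr_chord; lra.
rewrite /Repow -raddfD; congr complex.Re.
set x := e * chord y; set x' := e * (- y / chord y).
have xy : x ^+ 2 = 1 - y ^+ 2 by rewrite /x exprMn e1 mul1r.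
have x'x : x' * x = - y.
  by rewrite -[RHS]mul1r -e1 /x /x'; field.
have k : - 'i%C * (x' +i* 1)%C * ((x +i* y)%C ^+ 2 + 1) = 2%:R * (x +i* y)%C ^+ 2.
  have x'xy : x' * x * y = - y ^+ 2 by rewrite x'x; ring.
  have x'xx : x' * x ^+ 2 = - (y * x) by rewrite expr2 mulrA x'x; ring.
  have x'yy : x' * x ^+ 2 = x' - x' * y ^+ 2 by rewrite xy; ring.
  (* Both components follow linearly from xy and the three identities above. *)
  rewrite !expr2 mulr_natl mulr2n; apply/eqP; rewrite eq_complex /=.
  by apply/andP; split; apply/eqP; lra.
set w := (x +i* y)%C in k *.
have -> : w ^+ n.+2 = w ^+ n * w ^+ 2 by rewrite -exprD addn2.
have -> : c * (w ^+ n * w ^+ 2) = c * w ^+ n * (2%:R * w ^+ 2) / 2 by field.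
rewrite -k.
by field; rewrite nat1r -natrD !pnatr_eq0.
Qed.

(** Both arcs end at the point i. *)
Lemma arc_prim1 c e n : arc_prim c e n 1 = arc_prim c (- e) n 1.
Proof. by rewrite /arc_prim /chord expr1n subrr sqrtr0 !mulr0. Qed.

(** The arcs start at e = 1 and e = -1. *)
Lemma arc_prim0 c e n : arc_prim c e n 0 = complex.Re
  (c * (- 'i%C / 2) * (e%:C%C ^+ n.+2 / n.+2%:R + e%:C%C ^+ n / n%:R)).
Proof.
rewrite /arc_prim /chord expr0n subr0 sqrtr1 mulr1 /Repow -raddfD.
by congr complex.Re; rewrite mulrDr; congr (_ + _); rewrite mulrAC mulrA.
Qed.

Lemma integral_arcs c n :
  (\int[lebesgue_measure]_(y in `[0%R, 1%R])
    (Repow c n.+2 (chord y) y - Repow c n.+2 (- chord y) y)%:E)%E =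
  (complex.Re (c * n.+2%:R *
    ('i%C * (1 - (- 1) ^+ n.+1) / (n.+1 * n.+3)%:R)))%:E.
Proof.
rewrite (integral_itv_derive
  (F := fun y => arc_prim c 1 n.+1 y - arc_prim c (- 1) n.+1 y)).
- (* The boundary values are generalized because unifying two instances of
     arc_prim up to conversion unfolds the square roots. *)
  move: (arc_prim1 c 1 n.+1) (arc_prim0 c 1 n.+1) (arc_prim0 c (- 1) n.+1).
  move: (arc_prim _ 1 _ 1) (arc_prim _ (- 1) _ 1) => a _ <-.
  move=> -> ->; rewrite subrr sub0r opprB -raddfB.
  congr (complex.Re _)%:E; rewrite rmorphN rmorph1 !expr1n.
  have -> : (- 1) ^+ n.+3 = (- 1) ^+ n.+1 :> R[i].
    by rewrite -addn2 exprD sqrrN expr1n mulr1.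
  rewrite natrM.
  by field; rewrite nat1r -natrD !pnatr_eq0.
- exact: ler01.
- have cid : continuous (fun y : R => y) by move=> y; exact: cvg_id.
  have c1 := continuous_chord.
  have c2 : continuous (fun y : R => - chord y) by move=> y; apply: cvgN; exact: c1.
  have cR1 := @continuous_Repow c n.+2 _ _ _ c1 cid.
  have cR2 := @continuous_Repow c n.+2 _ _ _ c2 cid.
  by move=> y; apply: cvgB; [exact: cR1|exact: cR2].
- by move=> y; apply: cvgB; exact: continuous_arc_prim.
- move=> y y01.
  have d1 := is_derive_arc_prim c n (expr1n R 2) y01.
  have d2 := is_derive_arc_prim c n (etrans (sqrrN 1) (expr1n R 2)) y01.
  have := is_deriveB d1 d2.
  by rewrite mul1r mulN1r.
Qed.

(** * Fubini on the half disc *)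

Lemma measurable_B : measurable (@B R : set (measurableTypeR R * measurableTypeR R)).
Proof.
rewrite (_ : @B R = (snd @^-1` `[0, +oo[) `&`
    ((fun p : measurableTypeR R * measurableTypeR R =>
       p.1 ^+ 2 + p.2 ^+ 2) @^-1` `]-oo, 1])).
  apply: measurableI; rewrite -[X in measurable X]setTI.
    exact: measurable_snd.
  apply: measurable_funD => //; exact: measurable_funX.
by apply/seteqP; split=> p /=; rewrite !in_itv /= andbT.
Qed.

Lemma lebesgue_B_lty : (@lebesgue_measure2 R (@B R) < +oo)%E.
Proof.
have sB : @B R `<=` `[-1, 1] `*` `[-1, 1].
  by move=> p [? ?]; split; rewrite /= in_itv /=; nra.
have mI : measurable (`[-1, 1] : set (measurableTypeR R)) by [].
have := @le_measure _ _ _ (@lebesgue_measure2 R) (@B R) (`[-1, 1] `*` `[-1, 1]).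
rewrite !inE => /(_ measurable_B (measurableX mI mI) sB) /le_lt_trans; apply.
rewrite [ltLHS](product_measure1E (@lebesgue_measure R) (@lebesgue_measure R) mI mI).
have fI : ((@lebesgue_measure R : set R -> _) `[(-1)%R, 1%R]%classic < +oo)%E.
  by rewrite lebesgue_measure_itv /=; case: ifP => _; rewrite -?EFinB ltry.
apply: lte_mul_pinfty; [exact: measure_ge0| |exact: fI].
by rewrite ge0_fin_numE; [exact: fI|exact: measure_ge0].
Qed.

Lemma B_slice y x : B (x, y) <-> (0 <= y <= 1 /\ - chord y <= x <= chord y).
Proof.
rewrite /B /=; split=> [[y0 xy]|[/andP[y0 y1] xs]].
  have y1 : y <= 1 by nra.
  by rewrite y0 y1 -ler_norml -sqrtr_sqr ler_sqrt; [split=> //; lra|nra].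
split=> //; have := @sqr_chord y; rewrite y0 y1 => /(_ isT); nra.
Qed.

Lemma integrable_Repow c n :
  (@lebesgue_measure2 R).-integrable (@B R) (EFin \o (fun p => Repow c n p.1 p.2)).
Proof.
apply: measurable_bounded_integrable.
- exact: measurable_B.
- exact: lebesgue_B_lty.
- apply: measurable_Repow; exact: measurable_funTS.
- exists (Num.sqrt (complex.Re c ^+ 2 + complex.Im c ^+ 2)).
  split; first exact: num_real.
  move=> M cM p [_ p1] /=; exact: le_trans (Repow_le _ _ p1) (ltW cM).
Qed.

Lemma Rintegral_B_Repow c n :
  \int[@lebesgue_measure2 R]_(p in @B R) Repow c n.+1 p.1 p.2 =
  complex.Re (c * ('i%C * (1 - (- 1) ^+ n.+1) / (n.+1 * n.+3)%:R)).
Proof.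
have n2 : n.+2%:R != 0 :> R[i] by rewrite pnatr_eq0.
(* Here c = (c / (n+2)) (n+2), and c / (n+2) is the factor left by the inner
   integration. *)
rewrite /Rintegral -[in RHS](mulfVK n2 c); apply: EFin_inj.
rewrite -integral_arcs fineK.
  rewrite integral_mkcond [RHS]integral_mkcond -integral21_prod_meas1; last first.
    exact/(integrable_mkcond _ measurable_B).1/integrable_Repow.
  apply: eq_integral => y _; rewrite /fubini_G [RHS]patchE.
  case: ifPn => [|].
    rewrite inE /= in_itv /= => y01.
    rewrite -integral_horizontal_Repow [RHS]integral_mkcond.
    apply: eq_integral => x _; rewrite !patchE.
    rewrite (_ : ((x, y) \in @B R) = (x \in `[- chord y, chord y]%classic))//.
    apply/idP/idP; rewrite !inE /= in_itv /=; first by move=> /B_slice[].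
    by move=> xs; exact/B_slice.
  move=> y01.
  apply: integral0_eq => x _; rewrite patchE ifF//.
  apply/negP; rewrite inE => /B_slice[y01' _]; move/negP: y01; apply.
  by rewrite inE /= in_itv /= y01'.
exact: (integrable_fin_num measurable_B (integrable_Repow c n.+1)).
Qed.

Lemma QE (p : R * R) : Q p = (p.1 +i* p.2)%C.
Proof. by rewrite /Q [RHS]complexE. Qed.

Lemma Cintegral_B_Q n :
  Cintegral (@lebesgue_measure2 R) (@B R) (fun p => Q p ^+ n.+1) =
  'i%C * (1 - (- 1) ^+ n.+1) / (n.+1 * n.+3)%:R.
Proof.
set v := RHS.
have ImE (z : R[i]) : complex.Im z = complex.Re (- 'i%C * z).
  by case: z => a b /=; ring.
apply/eqP; rewrite eq_complex /=; apply/andP; split; apply/eqP; last rewrite ImE.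
  rewrite -[v]mul1r -Rintegral_B_Repow.
  by apply: eq_Rintegral => p _; rewrite /Repow mul1r QE.
rewrite -Rintegral_B_Repow.
by apply: eq_Rintegral => p _; rewrite /Repow -QE ImE.
Qed.

End Repow.

Theorem proposition1p2 (R : realType) :
  (forall m : nat, (1 <= m)%N ->
     Cintegral (@lebesgue_measure2 R) (@B R) (fun p => P p ^+ m) = 0) /\
  (forall m : nat, (1 <= m)%N ->
     Cintegral (@lebesgue_measure2 R) (@B R) (fun p => Q p * P p ^+ m) <> 0).
Proof.
have sgn2 k : (- 1 : R[i]) ^+ (2 * k) = 1 by rewrite exprM sqrrN !expr1n.
split=> -[//|m] _.
  rewrite (_ : (fun _ => _) = (fun p => Q p ^+ (2 * m).+2)).
    by rewrite Cintegral_B_Q -addn2 exprD sgn2 sqrrN expr1n mulr1 subrr mulr0 mul0r.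
  by apply/funext => p; rewrite -addn2 -mulnSr exprM.
rewrite (_ : (fun _ => _) = (fun p => Q p ^+ (2 * m.+1).+1)).
  rewrite Cintegral_B_Q exprS sgn2 mulr1 opprK; apply/eqP.
  apply: mulf_neq0; last by rewrite invr_eq0 pnatr_eq0.
  apply: mulf_neq0; last by rewrite (_ : 1 + 1 = 2%:R)// pnatr_eq0.
  by rewrite eq_complex /= oner_eq0 andbF.
by apply/funext => p; rewrite [RHS]exprS exprM.
Qed.
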